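(* Let $K$ be a field of characteristic zero, let a domain $R$ be a commutative finitely generated $K$-algebra of Krull dimension $n>0$, let $\mathcal D(R)=\bigcup_{i\ge0}\mathcal D(R)_i$ be the ring of differential operators on $R$ with its order filtration, and let $x_1,\ldots,x_n$ be algebraically independent (over $K$) elements of $R$. Then 1. $\delta_1:=\mathrm{ad}(x_1),\ldots,\delta_n:=\mathrm{ad}(x_n)$ is a set of commuting locally nilpotent derivations of the algebra $\mathcal D(R)$. 2. The order filtration $\{\mathcal D(R)_i\}$ coincides with the filtration $\{N_i\}$ associated with the derivations $\delta_1,\ldots,\delta_n$, i.e. $\mathcal D(R)_i=N_i$ for all $i\ge0$. In particular, $\mathcal D(R)^\delta=R$.
   Context: $[a,b]=ab-ba$ and $\mathrm{ad}(a)(b)=[a,b]$. $\mathcal D(R)$ is the $K$-subalgebra $\bigcup_{i\ge0}\mathcal D(R)_i$ of $\mathrm{End}_K(R)$, where $\mathcal D(R)_0=\mathrm{End}_R(R)\simeq R$ (elements $r\in R$ identified with multiplication maps $x\mapsto rx$) and, for $i\ge1$, $\mathcal D(R)_i=\{u\in\mathrm{End}_K(R)\mid[u,r]\in\mathcal D(R)_{i-1}\text{ for all }r\in R\}$. A derivation is locally nilpotent if each element is killed by some power of it. With $\delta^\alpha=\delta_1^{\alpha_1}\cdots\delta_n^{\alpha_n}$ and $|\alpha|=\alpha_1+\cdots+\alpha_n$, the filtration associated with the $\delta_i$ is $N_i=\{u\in\mathcal D(R)\mid\delta^\alpha(u)=0\text{ for all }\alpha\in\mathbb N^n\text{ with }|\alpha|>i\}$,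 and $\mathcal D(R)^\delta=\bigcap_{i=1}^n\ker\delta_i$. *)

(* Defs.v *)
From HB Require Import structures.
From mathcomp Require Import all_boot all_order all_algebra.
From mathcomp Require Import boolp.
From mathcomp Require Import mpoly.

Set Implicit Arguments.
Unset Strict Implicit.
Unset Printing Implicit Defensive.

Import GRing.Theory.
Local Open Scope ring_scope.

(* A subset of R is a boolean predicate; classical logic (boolp) makes this
   no restriction. *)
Definition prime_ideal (R : comNzRingType) (P : {pred R}) : Prop :=
  idealr_closed P /\ prime_idealr_closed P.

Definition prime_chain (R : comNzRingType) (m : nat) : Prop :=
  exists P : 'I_m.+1 -> {pred R},
    (forall i, prime_ideal (P i)) /\
    (forall i j : 'I_m.+1, (i < j)%N ->
       {subset P i <= P j} /\ ~ {subset P j <= P i}).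

Definition has_krull_dim (R : comNzRingType) (n : nat) : Prop :=
  prime_chain R n /\ forall m, prime_chain R m -> (m <= n)%N.

Definition finitely_generated (K : fieldType) (R : comAlgType K) : Prop :=
  exists m (g : 'I_m -> R),
    forall r, exists p : {mpoly K[m]}, r = mmap (in_alg R) g p.

Definition alg_independent (K : fieldType) (R : comAlgType K) (n : nat)
    (x : 'I_n -> R) : Prop :=
  forall p : {mpoly K[n]}, mmap (in_alg R) x p = 0 -> p = 0.

Definition ad (A : nzRingType) (a b : A) : A := a * b - b * a.

Definition derivation (K : fieldType) (A : algType K) (d : A -> A) : Prop :=
  linear d /\ (forall a b, d (a * b) = d a * b + a * d b).

Definition locally_nilpotent (A : nmodType) (d : A -> A) : Prop :=
  forall a, exists k, iter k d a = 0.

(* d_1^(alpha_1) \o ... \o d_n^(alpha_n), in this order. *)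
Definition multi_iter (A : Type) (n : nat) (d : 'I_n -> A -> A)
    (alpha : 'X_{1..n}) : A -> A :=
  \big[(fun f g => f \o g)/id]_(i < n) iter (alpha i) (d i).

Definition assoc_filtration (A : nmodType) (n : nat) (d : 'I_n -> A -> A)
    (i : nat) (a : A) : Prop :=
  forall alpha : 'X_{1..n}, (i < mdeg alpha)%N -> multi_iter d alpha a = 0.

(* The algebra End_K(R), with composition as multiplication. *)
Record KEnd (K : fieldType) (R : comAlgType K) : Type :=
  MkKEnd { kend_fun :> {linear R -> R} }.

HB.instance Definition _ (K : fieldType) (R : comAlgType K) :=
  gen_eqMixin (KEnd R).
HB.instance Definition _ (K : fieldType) (R : comAlgType K) :=
  gen_choiceMixin (KEnd R).

Section KEndAlgebra.
Context (K : fieldType) (R : comAlgType K).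
Implicit Types (u v w : KEnd R) (a b : K).

Lemma kend_ext u v : u =1 v -> u = v.
Proof.
case: u => -[f [[Af] [Zf]]]; case: v => -[g [[Ag] [Zg]]] /= /funext efg.
case: _ / efg in Ag Zg *; congr MkKEnd.
by rewrite (Prop_irrelevance Af Ag) (Prop_irrelevance Zf Zg).
Qed.

Definition kend_zero : KEnd R := MkKEnd \0.
Definition kend_opp u : KEnd R := MkKEnd (\- u).
Definition kend_add u v : KEnd R := MkKEnd (u \+ v).
Definition kend_one : KEnd R := MkKEnd idfun.
Definition kend_mul u v : KEnd R := MkKEnd (u \o v).
Definition kend_scale a u : KEnd R := MkKEnd (a \*: u).

Lemma kend_addA : associative kend_add.
Proof. by move=> u v w; apply: kend_ext => x /=; exact: addrA. Qed.
Lemma kend_addC : commutative kend_add.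
Proof. by move=> u v; apply: kend_ext => x /=; exact: addrC. Qed.
Lemma kend_add0 : left_id kend_zero kend_add.
Proof. by move=> u; apply: kend_ext => x /=; exact: add0r. Qed.
Lemma kend_addN : left_inverse kend_zero kend_opp kend_add.
Proof. by move=> u; apply: kend_ext => x /=; exact: addNr. Qed.

HB.instance Definition _ :=
  GRing.isZmodule.Build (KEnd R) kend_addA kend_addC kend_add0 kend_addN.

Lemma kend_mulA : associative kend_mul.
Proof. by move=> u v w; apply: kend_ext. Qed.
Lemma kend_mul1 : left_id kend_one kend_mul.
Proof. by move=> u; apply: kend_ext. Qed.
Lemma kend_mulr1 : right_id kend_one kend_mul.
Proof. by move=> u; apply: kend_ext. Qed.
Lemma kend_mulDl : left_distributive kend_mul +%R.
Proof. by move=> u v w; apply: kend_ext. Qed.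
Lemma kend_mulDr : right_distributive kend_mul +%R.
Proof. by move=> u v w; apply: kend_ext => x; exact: raddfD. Qed.
Lemma kend_1neq0 : kend_one != 0.
Proof.
by apply/eqP => /(congr1 (fun u : KEnd R => u 1)) /eqP; rewrite oner_eq0.
Qed.

HB.instance Definition _ := GRing.Zmodule_isNzRing.Build (KEnd R)
  kend_mulA kend_mul1 kend_mulr1 kend_mulDl kend_mulDr kend_1neq0.

Lemma kend_scaleA a b u : kend_scale a (kend_scale b u) = kend_scale (a * b) u.
Proof. by apply: kend_ext => x; exact: scalerA. Qed.
Lemma kend_scale1 : left_id 1 kend_scale.
Proof. by move=> u; apply: kend_ext => x; exact: scale1r. Qed.
Lemma kend_scaleDr : right_distributive kend_scale +%R.
Proof. by move=> a u v; apply: kend_ext => x; exact: scalerDr. Qed.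
Lemma kend_scaleDl u : {morph kend_scale^~ u : a b / a + b}.
Proof. by move=> a b; apply: kend_ext => x; exact: scalerDl. Qed.

HB.instance Definition _ := GRing.Zmodule_isLmodule.Build K (KEnd R)
  kend_scaleA kend_scale1 kend_scaleDr kend_scaleDl.

Lemma kend_scaleAl a u v : a *: (u * v) = (a *: u) * v.
Proof. by apply: kend_ext. Qed.
HB.instance Definition _ := GRing.Lmodule_isLalgebra.Build K (KEnd R)
  kend_scaleAl.

Lemma kend_scaleAr a u v : a *: (u * v) = u * (a *: v).
Proof. by apply: kend_ext => x; exact: esym (linearZ_LR u a (v x)). Qed.
HB.instance Definition _ := GRing.Lalgebra_isAlgebra.Build K (KEnd R)
  kend_scaleAr.

Lemma kend0E x : (0 : KEnd R) x = 0. Proof. by []. Qed.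
Lemma kend1E x : (1 : KEnd R) x = x. Proof. by []. Qed.
Lemma kendDE u v x : (u + v) x = u x + v x. Proof. by []. Qed.
Lemma kendNE u x : (- u) x = - u x. Proof. by []. Qed.
Lemma kendME u v x : (u * v) x = u (v x). Proof. by []. Qed.
Lemma kendZE a u x : (a *: u) x = a *: u x. Proof. by []. Qed.

End KEndAlgebra.

Definition mulop (K : fieldType) (R : comAlgType K) (r : R) : KEnd R :=
  MkKEnd (r \*o idfun).

(* D(R)_i inside End_K(R); for i = 0 this is R-linearity, additivity being
   part of KEnd. *)
Fixpoint order_le (K : fieldType) (R : comAlgType K) (i : nat) (u : KEnd R)
    : Prop :=
  match i with
  | 0 => forall r x : R, u (r * x) = r * u x
  | j.+1 => forall r : R, order_le j (ad u (mulop r))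
  end.

Definition is_diffop (K : fieldType) (R : comAlgType K) : {pred KEnd R} :=
  fun u => `[< exists i, order_le i u >].

Arguments is_diffop {K} R u.

Section DiffOpAlgebra.
Context (K : fieldType) (R : comAlgType K).
Implicit Types (u v : KEnd R) (a : K) (i j : nat).

Lemma mulopE (r x : R) : mulop r x = r * x. Proof. by []. Qed.

Lemma order_le0 i : order_le i (0 : KEnd R).
Proof.
elim: i => [|i IH] r; first by move=> x; exact: esym (mulr0 r).
by rewrite /ad mul0r mulr0 subrr.
Qed.

Lemma ad_mulop0 u r : order_le 0 u -> ad u (mulop r) = 0.
Proof.
by move=> Hu; apply: kend_ext => x;
   rewrite kendDE kendNE !kendME !mulopE Hu subrr.
Qed.

Lemma order_leS i u : order_le i u -> order_le i.+1 u.
Proof.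
elim: i u => [|i IH] u Hu r; last by apply: IH; exact: Hu.
by change (order_le 0 (ad u (mulop r))); rewrite ad_mulop0 //; exact: order_le0.
Qed.

Lemma order_le_leq i j u : (i <= j)%N -> order_le i u -> order_le j u.
Proof. by move/subnK<-; elim: (j - i)%N => //= k IH /IH; exact: order_leS. Qed.

Lemma order_leD i u v : order_le i u -> order_le i v -> order_le i (u + v).
Proof.
elim: i u v => [|i IH] u v Hu Hv r.
  by move=> x; rewrite !kendDE Hu Hv mulrDr.
rewrite /ad mulrDl mulrDr opprD addrACA.
exact: (IH _ _ (Hu r) (Hv r)).
Qed.

Lemma order_leZ i a u : order_le i u -> order_le i (a *: u).
Proof.
elim: i u => [|i IH] u Hu r; first by move=> x; rewrite !kendZE Hu scalerAr.
by rewrite /ad -scalerAl -scalerAr -scalerBr; exact: (IH _ (Hu r)).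
Qed.

Lemma ad_mull u v w : ad (u * v) w = u * ad v w + ad u w * v.
Proof. by rewrite /ad mulrBr mulrBl !mulrA addrA subrK. Qed.

Lemma order_leM i j u v :
  order_le i u -> order_le j v -> order_le (i + j)%N (u * v).
Proof.
elim: {i j}(i + j)%N {-2}i {-2}j (erefl (i + j)%N) u v
  => [|k IH] [|i] [|j] // ek u v Hu Hv.
- by move=> r x; rewrite !kendME Hv Hu.
- move=> r; rewrite ad_mull (ad_mulop0 _ Hu) mul0r addr0.
  by case: ek => ek; exact: (IH 0%N j ek).
- move: ek; rewrite addn0 => -[ek] r; rewrite ad_mull (ad_mulop0 _ Hv).
  by rewrite mulr0 add0r -[i]addn0; apply: (IH i 0%N); rewrite ?addn0.
- move=> r; case: ek => ek; rewrite ad_mull; apply: order_leD.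
    by rewrite addnS -addSn; apply: (IH i.+1 j); rewrite // addSnnS.
  exact: (IH i j.+1).
Qed.

Lemma order_le1 : order_le 0 (1 : KEnd R).
Proof. by []. Qed.

Lemma is_diffopP u : reflect (exists i, order_le i u) (u \in is_diffop R).
Proof. exact: asboolP. Qed.

Lemma is_diffop_subalg : GRing.subsemialg_closed (is_diffop R).
Proof.
split.
- by apply/is_diffopP; exists 0%N.
- split=> [|u v /is_diffopP[i Hu] /is_diffopP[j Hv]]; apply/is_diffopP.
    by exists 0%N; exact: order_le0.
  exists (i + j)%N; apply: order_leD.
    exact: order_le_leq (leq_addr _ _) Hu.
  exact: order_le_leq (leq_addl _ _) Hv.
- move=> a u /is_diffopP[i Hu]; apply/is_diffopP; exists i.
  exact: order_leZ.
- move=> u v /is_diffopP[i Hu] /is_diffopP[j Hv]; apply/is_diffopP.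
  by exists (i + j)%N; exact: order_leM.
Qed.

Lemma mulop_diffop (r : R) : mulop r \in is_diffop R.
Proof. by apply/is_diffopP; exists 0%N => s x; rewrite !mulopE mulrCA. Qed.

End DiffOpAlgebra.

Record DiffOp (K : fieldType) (R : comAlgType K) : Type :=
  MkDiffOp { diffop_val :> KEnd R; _ : diffop_val \in is_diffop R }.

HB.instance Definition _ (K : fieldType) (R : comAlgType K) :=
  [isSub for @diffop_val K R].
HB.instance Definition _ (K : fieldType) (R : comAlgType K) :=
  [Choice of DiffOp R by <:].
HB.instance Definition _ (K : fieldType) (R : comAlgType K) :=
  GRing.SubChoice_isSubAlgebra.Build K (KEnd R) (is_diffop R) (DiffOp R)
    (@is_diffop_subalg K R).

Definition diffop_mul (K : fieldType) (R : comAlgType K) (r : R) : DiffOp R :=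
  MkDiffOp (mulop_diffop r).

(* Each D(R)_i lies in D(R), so nothing is lost by viewing it as a subset of
   DiffOp R. *)
Definition order_filtration (K : fieldType) (R : comAlgType K) (i : nat)
    (u : DiffOp R) : Prop :=
  order_le i (u : KEnd R).

(* Main.v *)
From HB Require Import structures.
Require Import Defs.
From mathcomp Require Import all_boot all_order all_algebra.
From mathcomp Require Import boolp classical_sets mpoly.
From mathcomp Require Import ring.

Set Implicit Arguments.
Unset Strict Implicit.
Unset Printing Implicit Defensive.

Import GRing.Theory.
Local Open Scope ring_scope.

(** If u in D(R) commutes with the x_i, then by induction on the order every
    commutator [u, r] is R-linear. Since r is algebraic over K[x], there is a
    polynomial p over K[x] with p(r) = 0 and p'(r) <> 0, and
    0 = [u, p(r)] = p'(r) [u, r] forces [u, r] = 0. Hence D(R)^delta = R, and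
    N_i = D(R)_i follows by induction on i, because delta^alpha and ad(r)
    commute.

    That r is algebraic over K[x] is dimension theory: a finitely generated
    domain A with m algebraically independent elements has a chain of primes
    of length m. To see it, take a transcendence basis y_1, ..., y_k of A with
    k >= m. Some nonzero f in A divides no nonzero element of
    K[y_1, ..., y_(k-1)], so Zorn's lemma gives a nonzero prime P whose
    intersection with K[y_1, ..., y_(k-1)] is 0; recurse on A / P. *)

(** * Algebraic elements, integral multiples and common denominators *)

Definition algebraic_over (B A : nzRingType) (f : B -> A) (a : A) : Prop :=
  exists2 p : {poly B}, p != 0 & root (map_poly f p) a.

(** Generation as an algebra over the image of [f], encoded as an induction principle. *)
Definition generated_over (B A : nzRingType) (f : B -> A) (s : seq A) : Prop :=
  forall P : A -> Prop,
    (forall b, P (f b)) -> {in s, forall a, P a} ->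
    (forall a b, P a -> P b -> P (a + b)) ->
    (forall a b, P a -> P b -> P (a * b)) -> forall a, P a.

(** Multiplying an equation of degree [d + 1] for [a] by the [d]-th power of its leading coefficient
    [l] gives a monic equation for [l * a]. *)
Lemma integral_lead_coef_mul (B A : comNzRingType) (f : {rmorphism B -> A})
    (p : {poly B}) (a : A) :
  root (map_poly f p) a -> integralOver f (f (lead_coef p) * a).
Proof.
move=> /rootP pa0; case sp: (size p) => [|[|d]].
- by rewrite lead_coefE sp /= nth_default ?sp // rmorph0 mul0r; apply: integral0.
- move: pa0; have /size1_polyC -> : (size p <= 1)%N by rewrite sp.
  rewrite map_polyC hornerC lead_coefC => ->.
  by rewrite mul0r; apply: integral0.
set l := lead_coef p; pose q := \poly_(i < d.+1) (p`_i * l ^+ (d - i)).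
exists ('X^(d.+1) + q).
  by rewrite monicE lead_coefDl ?lead_coefXn // size_polyXn ltnS size_poly.
apply/rootP; rewrite rmorphD /= map_polyXn hornerD hornerXn.
have -> : map_poly f q = \poly_(i < d.+1) (f p`_i * f l ^+ (d - i)).
  apply/polyP=> i; rewrite coef_map [q`_i]coef_poly coef_poly; case: ifP => _.
    by rewrite /= rmorphM rmorphXn.
  by rewrite /= rmorph0.
rewrite horner_poly.
have := congr1 ( *%R (f l ^+ d)) pa0; rewrite mulr0.
have sfp : (size (map_poly f p) <= d.+2)%N by rewrite -sp size_poly.
rewrite (horner_coef_wide _ sfp) mulr_sumr big_ord_recr /= addrC.
have -> : (map_poly f p)`_d.+1 = f l by rewrite coef_map /= /l lead_coefE sp.
rewrite mulrA -exprSr -exprMn => pa1; rewrite -[RHS]pa1; congr (_ + _).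
apply: eq_bigr => i _.
have ed : f l ^+ d = f l ^+ (d - i) * f l ^+ i.
  by rewrite -exprD subnK // -ltnS.
rewrite coef_map /= exprMn ed !mulrA; congr (_ * _).
by rewrite [RHS]mulrC mulrA.
Qed.

(** [h] is the product of the leading coefficients of equations for the generators. A product of [M]
    generators calls for [h ^+ M], hence an exponent that depends on [a]. *)
Lemma generated_common_denominator (B : idomainType) (A : comNzRingType)
    (f : {rmorphism B -> A}) (s : seq A) :
  generated_over f s -> {in s, forall a, algebraic_over f a} ->
  exists2 h : B, h != 0 & forall a, exists M, integralOver f (f (h ^+ M) * a).
Proof.
move=> genA algs.
have [h h_neq0 hs] : exists2 h : B, h != 0 &
    {in s, forall a, integralOver f (f h * a)}.
  elim: s algs {genA} => [|a s IH] algs; first by exists 1; rewrite ?oner_eq0.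
  have [|h h0 hs] := IH; first by move=> b bs; apply: algs; rewrite inE bs orbT.
  have [p p0 pa] := algs a (mem_head _ _).
  exists (lead_coef p * h); first by rewrite mulf_neq0 ?lead_coef_eq0.
  move=> b; rewrite inE rmorphM /= => /orP[/eqP ->|bs].
    rewrite mulrAC; apply: integral_mul; last exact: integral_id.
    exact: integral_lead_coef_mul.
  by rewrite -mulrA; apply: integral_mul; [exact: integral_id|exact: hs].
exists h => //; apply: genA => [b|a /hs ha|a b [M Ma] [N Nb]|a b [M Ma] [N Nb]].
- by exists 0%N; rewrite -rmorphM; apply: integral_id.
- by exists 1%N; rewrite expr1.
- exists (M + N)%N; rewrite exprD rmorphM mulrDr; apply: integral_add.
    by rewrite mulrAC; apply: integral_mul; last exact: integral_id.
  by rewrite -mulrA; apply: integral_mul; first exact: integral_id.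
- exists (M + N)%N; rewrite exprD rmorphM mulrACA.
  exact: integral_mul.
Qed.

(* The witness is q = 1 + X h with h a common denominator of A over B[X]: if
   q g = b, then h^M g is integral over B[X], so q divides h^(Md) b^d for some
   d, hence b^d because X h = -1 modulo q; as q is not constant, b = 0. *)
Lemma exists_avoiding_multiples (B : idomainType) (A : comNzRingType)
    (f : {rmorphism {poly B} -> A}) (s : seq A) :
  injective f -> generated_over f s -> {in s, forall a, algebraic_over f a} ->
  exists2 q, q != 0 & forall g b, q * g = f b%:P -> b = 0.
Proof.
move=> inj_f genA algs.
have [h h0 hP] := generated_common_denominator genA algs.
pose q := 1 + 'X * h.
have sXh : (1 < size ('X * h)%R)%N.
  by rewrite mulrC size_mulX // ltnS size_poly_gt0.
have sq : (1 < size q)%N by rewrite /q addrC size_polyDl // size_poly1.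
have q0 : q != 0 by rewrite -size_poly_gt0 ltnW.
exists (f q); first by rewrite -(rmorph0 f) (inj_eq inj_f).
move=> g b qg; have [M [P monP /rootP Pg0]] := hP g.
pose d := (size P).-1.
have sP : size P = d.+1 by rewrite prednK // size_poly_gt0 monic_neq0.
have [w hw] : exists w, h ^+ (M * d) * b%:P ^+ d = q * w.
  (* Multiply the monic equation of [h ^+ M * g] by [q ^+ d] and replace [q * g] by [b]: the top
     term becomes the left side, and all others keep a factor [q]. *)
  exists (- \sum_(i < d) P`_i * h ^+ (M * i) * b%:P ^+ i * q ^+ (d - i).-1).
  apply: inj_f; rewrite mulrN mulr_sumr rmorphN rmorph_sum /=.
  apply/eqP; rewrite -addr_eq0; apply/eqP.
  have sfP : (size (map_poly f P) <= d.+1)%N by rewrite -sP size_poly.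
  have := congr1 ( *%R (f q ^+ d)) Pg0; rewrite mulr0 => Pg1; rewrite -[RHS]Pg1.
  rewrite (horner_coef_wide _ sfP) mulr_sumr big_ord_recr /= [RHS]addrC.
congr (_ + _); last first.
    apply: eq_bigr => i _; rewrite coef_map /=.
    have -> : (f (h ^+ M) * g) ^+ i = f (h ^+ (M * i)) * g ^+ i.
      by rewrite exprMn -rmorphXn -exprM.
    have ed : f q ^+ d = f q * f q ^+ (d - i).-1 * f q ^+ i.
      by rewrite -exprS prednK ?subn_gt0 // -exprD subnK // ltnW.
    by rewrite ed !rmorphM !rmorphXn /= -qg exprMn; ring.
  rewrite coef_map /=.
  have -> : P`_d = 1 by rewrite -(monicP monP) lead_coefE.
  by rewrite rmorph1 mul1r rmorphM !rmorphXn /= -qg !exprMn exprM; ring.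
have modq k : exists z, ('X * h) ^+ k = (-1) ^+ k + q * z.
  elim: k => [|k [z IH]]; first by exists 0; rewrite mulr0 addr0.
  exists ((-1) ^+ k + 'X * h * z); rewrite exprS IH.
  have -> : 'X * h = q - 1 by rewrite /q addrC addKr.
  by rewrite exprS; ring.
have [z hz] := modq (M * d)%N.
have qdvd : q * ('X^(M * d) * w - z * b%:P ^+ d) = (-1) ^+ (M * d) * b%:P ^+ d.
  by rewrite mulrBr mulrCA -hw mulrA -exprMn hz mulrDl mulrA addrK.
set y := 'X^_ * w - _ in qdvd.
apply/eqP; apply: contraLR sq => b0; rewrite -leqNgt.
have sqy : size (q * y) = 1%N.
  rewrite qdvd -signr_odd mulr_sign -polyC_exp.
  by case: ifP; rewrite ?size_polyN size_polyC expf_neq0.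
have y0 : y != 0.
  by apply: contra_eq_neq sqy => ->; rewrite mulr0 size_poly0.
rewrite -sqy size_mul // -subn1 leq_subRL ?addn_gt0 ?size_poly_gt0 ?q0 //.
by rewrite addnC leq_add2l size_poly_gt0.
Qed.

(** * Prime ideals: quotients, avoidance of multiplicative sets, chains *)

Lemma exists_prime_quotient (A : comNzRingType) (P : {pred A}) :
  prime_ideal P ->
  exists (C : comNzRingType) (f : {rmorphism A -> C}),
    [/\ GRing.integral_domain_axiom C, forall c, exists a, f a = c
      & forall a, (f a == 0) = (a \in P)].
Proof.
move=> [idP primeP].
pose I : prime_idealr A :=
  HB.pack P (isIdealr.Build A P idP) (isPrimeIdealrClosed.Build A P primeP).
exists {ideal_quot I}, \pi_{ideal_quot I}%qT; split.
- exact: Quotient.rquot_IdomainAxiom.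
- by move=> c; exists (generic_quotient.repr c); exact: generic_quotient.reprK.
- move=> a; rewrite -[RHS]/(a \in I) -[in RHS](subr0 a).
  by rewrite Quotient.idealrBE rmorph0.
Qed.

(** Zorn's lemma gives a maximal ideal among those that contain [f] and miss the multiplicative set
    [S]; maximality makes it prime. *)
Lemma exists_prime_avoiding (A : comNzRingType) (S : A -> Prop) (f : A) :
  S 1 -> (forall a b, S a -> S b -> S (a * b)) -> (forall a, ~ S (f * a)) ->
  exists P : {pred A},
    [/\ prime_ideal P, f \in P & forall a, a \in P -> ~ S a].
Proof.
move=> S1 SM Sf.
pose good (X : set A) := [/\ X f, forall a u v, X u -> X v -> X (a * u + v)
  & forall u, X u -> ~ S u].
have [F FP totF|M [gM maxM]] := @Zorn_bigcup A (fun X => X = set0 \/ good X).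
  have [F0|] := pselect (forall X, F X -> X = set0).
    by left; apply/seteqP; split=> // a [X /F0 ->].
  move=> /existsNP[X0 /not_implyP[FX0 X0n]]; right.
  have goodF X a : F X -> X a -> good X by move=> /FP[-> //|].
  have [gX0|[gX0 _ _]] := FP _ FX0; first by case: X0n.
  split; first by exists X0.
    move=> a u v [X FX Xu] [Y FY Yv].
    have [XY|YX] := totF _ _ FX FY.
      by exists Y => //; have [_ + _] := goodF _ _ FY Yv; apply=> //; apply: XY.
    by exists X => //; have [_ + _] := goodF _ _ FX Xu; apply=> //; apply: YX.
  by move=> u [X FX Xu]; have [_ _] := goodF _ _ FX Xu; apply.
case: gM => [M0|[Mf Mlin MS]].
  case: (maxM (fun b => exists a, b = f * a)).
    rewrite M0; split; first by move=> ? [].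
    by move=> /(_ f); apply; exists 1; rewrite mulr1.
  right; split; first by exists 1; rewrite mulr1.
    move=> a _ _ [b ->] [c ->]; exists (a * b + c); ring.
  by move=> _ [a ->].
have M0 : M 0 by rewrite -(addNr f) -mulN1r; apply: Mlin.
(* By maximality the strictly larger ideal [M + A u] meets [S]. *)
have hitS u : ~ M u -> exists m a, M m /\ S (a * u + m).
  move=> nMu; apply: contrapT => nh.
  case: (maxM (fun b => exists m a, M m /\ b = a * u + m)).
    split; first by move=> m Mm; exists m, 0; rewrite mul0r add0r.
    by move=> /(_ u) h; apply: nMu; apply: h; exists 0, 1; rewrite mul1r addr0.
  right; split; first by exists f, 0; rewrite mul0r add0r.
    move=> a _ _ [m [b [Mm ->]]] [m' [c [Mm' ->]]].
    by exists (a * m + m'), (a * b + c); split; [exact: Mlin|ring].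
  by move=> _ [m [a [Mm ->]]] Ss; apply: nh; exists m, a.
exists (fun a => `[< M a >]); split.
- split; first split.
  + exact/asboolP.
  + by apply/negP=> /asboolP/MS; apply.
  + by move=> a u v /asboolP Mu /asboolP Mv; apply/asboolP/Mlin.
  move=> u v /asboolP Muv; apply: contrapT => /negP.
  rewrite negb_or => /andP[/asboolP nMu /asboolP nMv].
  have [m [a [Mm Sa]]] := hitS _ nMu; have [m' [b [Mm' Sb]]] := hitS _ nMv.
  apply: MS (SM _ _ Sa Sb).
  have -> : (a * u + m) * (b * v + m') =
    (a * b) * (u * v) + ((b * v + m') * m + (a * u * m' + 0)) by ring.
  exact: (Mlin _ _ _ Muv (Mlin _ _ _ Mm (Mlin _ _ _ Mm' M0))).
- exact/asboolP.
- by move=> a /asboolP/MS.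
Qed.

Lemma prime_ideal0 (A : comNzRingType) :
  GRing.integral_domain_axiom A -> prime_ideal (pred1 (0 : A)).
Proof.
move=> domA; split; last by move=> u v; rewrite !inE => /eqP/domA.
split; rewrite ?inE ?oner_eq0 // => a u v /eqP -> /eqP ->.
by rewrite mulr0 addr0 inE.
Qed.

Lemma prime_ideal_preim (A C : comNzRingType) (f : {rmorphism A -> C})
    (P : {pred C}) : prime_ideal P -> prime_ideal [pred a | f a \in P].
Proof.
move=> [[P0 P1 PD] PM]; split.
  split; rewrite ?inE ?rmorph0 ?rmorph1 // => a u v; rewrite !inE => Pu Pv.
  by rewrite rmorphD rmorphM; apply: PD.
by move=> u v; rewrite !inE rmorphM; apply: PM.
Qed.

(** The chain is pulled back along [f] and the zero ideal is put below it; [q] lies in every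
    preimage, so the new bottom step is strict. *)
Lemma prime_chain_lift (A C : comNzRingType) (f : {rmorphism A -> C})
    (q : A) (m : nat) :
  GRing.integral_domain_axiom A -> (forall c, exists a, f a = c) ->
  q != 0 -> f q = 0 -> prime_chain C m -> prime_chain A m.+1.
Proof.
move=> domA surj_f q0 fq0 [P [primeP chainP]].
pose Q (i : 'I_m.+2) : {pred A} :=
  if unlift ord0 i is Some j then [pred a | f a \in P j] else pred1 0.
exists Q; split.
  rewrite /Q => i; case: (unliftP ord0 i) => [j|] _; last exact: prime_ideal0.
  exact: prime_ideal_preim.
rewrite /Q => i j; case: (unliftP ord0 j) => [j' ->|-> //].
case: (unliftP ord0 i) => [i' ->|-> _].
  rewrite !lift0 ltnS => /chainP[sub nsub]; split.
    by move=> a; rewrite !inE => /sub.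
  by move=> sub'; apply: nsub => c; have [a <-] := surj_f c; apply: (sub' a).
have [[Pj0 _ _] _] := primeP j'; split.
  by move=> a; rewrite !inE => /eqP ->; rewrite rmorph0.
by move=> /(_ q); rewrite !inE fq0 => /(_ Pj0); rewrite (negPf q0).
Qed.

(** * Transcendence bases and chains of primes in finitely generated domains *)

Lemma generated_overS (B B' A : nzRingType) (f : B -> A) (g : B' -> A)
    (s : seq A) :
  (forall b, exists c, g c = f b) -> generated_over f s -> generated_over g s.
Proof.
move=> fg genf P Pg Ps PD PM; apply: genf => // b.
by have [c <-] := fg b.
Qed.

Lemma algebraic_over_comp (B B' A : nzRingType) (j : {rmorphism B -> B'})
    (f : B -> A) (g : {rmorphism B' -> A}) (a : A) :
  injective j -> (forall b, g (j b) = f b) ->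
  algebraic_over f a -> algebraic_over g a.
Proof.
move=> inj_j gj [p p0 pa]; exists (map_poly j p).
  rewrite (map_poly_eq0_id0 (f := j)) // -(rmorph0 j) (inj_eq inj_j).
  by rewrite lead_coef_eq0.
by rewrite -map_poly_comp_id0 ?rmorph0 // (eq_map_poly (g := f)).
Qed.

Lemma transcendental_extension (B A : comNzRingType) (f : {rmorphism B -> A})
    (a : A) :
  injective f -> ~ algebraic_over f a ->
  exists g : {rmorphism {poly B} -> A},
    [/\ injective g, forall b, g b%:P = f b & g 'X = a].
Proof.
move=> inj_f na; have cfa : commr_rmorph f a by move=> b; apply: mulrC.
exists (horner_morph cfa); split; last exact: horner_morphX.
  apply: raddf_inj => p pa; apply: contrapT => /eqP p0; apply: na.
  by exists p => //; apply/rootP.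
exact: horner_morphC.
Qed.

(** An iterated polynomial ring, so that splitting off the last variable is definitional. *)
Fixpoint tower (K : idomainType) (r : nat) : idomainType :=
  if r is r'.+1 then {poly tower K r'} else K.

(** Each generator that is transcendental over the current tower is adjoined as a new variable,
    until all are algebraic. *)
Lemma extend_to_transcendence_basis (K : idomainType) (A : comNzRingType)
    (s : seq A) (r : nat) (f : {rmorphism tower K r -> A}) :
  injective f -> generated_over f s ->
  exists r' (g : {rmorphism tower K r' -> A}),
    [/\ (r <= r')%N, injective g, generated_over g s
      & {in s, forall a, algebraic_over g a}].
Proof.
move=> inj_f gen_f.
(* [t] lists the generators still to be treated; those outside it are already algebraic. *)
have : exists t : seq A, {in s, forall a, a \in t \/ algebraic_over f a}.
  by exists s => a sa; left.
case=> t; elim: t => [|a t IH] in r f inj_f gen_f *.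
  by move=> algs; exists r, f; split=> // a /algs[].
move=> alga; have [fa|nfa] := pselect (algebraic_over f a).
  apply: (IH r f) => // b /alga[|]; last by right.
  by rewrite inE => /orP[/eqP ->|]; [right|left].
have [g [inj_g gC gX]] := transcendental_extension inj_f nfa.
have [|b|r' [h [rr' inj_h gen_h alg_h]]] := IH r.+1 g inj_g.
- by apply: generated_overS gen_f => b; exists b%:P; apply: gC.
- move=> /alga[|]; last first.
    by right; apply: algebraic_over_comp (@polyC_inj _) gC _.
  rewrite inE => /orP[/eqP ->|]; [right|by left].
  exists ('X - 'X%:P); first by rewrite polyXsubC_eq0.
  by rewrite map_polyXsubC gX root_XsubC.
by exists r', h; split=> //; apply: ltnW.
Qed.

(** Induction on [m] with [A] and [r] free: the step factors out a prime and keeps all but the last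
    variable of the tower. *)
Lemma prime_chain_tower (K : idomainType) (m r : nat) (A : comNzRingType)
    (f : {rmorphism tower K r -> A}) (s : seq A) :
  GRing.integral_domain_axiom A -> injective f -> generated_over f s ->
  (m <= r)%N -> prime_chain A m.
Proof.
elim: m r A f s => [|m IH] r A f s domA inj_f gen_f mr.
  exists (fun=> pred1 (0 : A) : {pred A}); split=> [i|i j]; first exact: prime_ideal0.
  by rewrite !ord1.
have [[|r'] [g [rr' inj_g gen_g alg_g]]] :=
  extend_to_transcendence_basis inj_f gen_f.
  by move: (leq_trans mr rr').
have [q q0 qP] := exists_avoiding_multiples inj_g gen_g alg_g.
(* Images of the nonzero polynomials in all but the last basis variable; a prime that misses them
   keeps these variables independent in the quotient. *)
pose S a := exists2 b : tower K r', b != 0 & a = g b%:P.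
have [|_ _ [b b0 ->] [c c0 ->]|a [b b0 /qP bz]|P [primeP Pq PS]] :=
    @exists_prime_avoiding A S q.
- by exists 1; rewrite ?oner_eq0 // rmorph1.
- by exists (b * c); rewrite ?mulf_neq0 // !rmorphM.
- by rewrite bz eqxx in b0.
have [C [pi [domC surj_pi kerpi]]] := exists_prime_quotient primeP.
apply: (prime_chain_lift domA surj_pi q0); first by apply/eqP; rewrite kerpi.
pose h : {rmorphism tower K r' -> C} := pi \o (g \o polyC).
(* The last variable has left the base ring, so its image joins the generators. *)
apply: (IH r' C h (map pi (g 'X :: s))) => //.
- apply: raddf_inj => b /eqP /=; rewrite kerpi => Pb; apply: contrapT => /eqP b0.
  by apply: (PS _ Pb); exists b.
- move=> Q Qh Qs QD QM c; have [a <-] := surj_pi c.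
  apply: (gen_g (fun a => Q (pi a))) => [p|b sb|b d|b d].
  + elim/poly_ind: p => [|p b Qp].
      by have := Qh 0; rewrite /h /= !rmorph0.
    rewrite !rmorphD !rmorphM; apply: QD; last exact: Qh.
    by apply: QM => //; apply: Qs; rewrite mem_head.
  + by apply: Qs; rewrite inE map_f ?orbT.
  + by rewrite rmorphD; apply: QD.
  + by rewrite rmorphM; apply: QM.
- by rewrite -ltnS (leq_trans mr).
Qed.

(** * Multivariate polynomials and algebraic dependence on the [x i] *)

Lemma muni_mwiden (n : nat) (K : nzRingType) (p : {mpoly K[n]}) :
  muni (mwiden p) = p%:P.
Proof.
elim/mpolyind: p => [|c m p _ _ IH]; first by rewrite mwiden0 muni0 polyC0.
rewrite mwidenD muniD IH polyCD mwidenZ muniZ mwidenX muniE msuppX big_seq1.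
rewrite mcoeffX eqxx scale1r mnmwiden_ordmax expr0.
have -> : [multinom mnmwiden m (widen_ord (leqnSn n) i) | i < n] = m.
  by apply/mnmP => i; rewrite mnmE mnmwiden_widen.
by rewrite alg_polyC -mul_polyC -polyCM mul_mpolyC.
Qed.

Lemma muniX_ord_max (n : nat) (K : nzRingType) :
  muni ('X_ord_max : {mpoly K[n.+1]}) = 'X.
Proof.
rewrite muniE msuppX big_seq1 mcoeffX eqxx scale1r mnm1E eqxx.
have -> : [multinom (U_(ord_max) : 'X_{1..n.+1})%MM
            (widen_ord (leqnSn n) i) | i < n] = 0%MM.
  by apply/mnmP => i; rewrite mnmE mnm1E mnm0E -val_eqE /= gtn_eqF.
by rewrite mpolyX0 scale1r.
Qed.

(** [muni] undoes evaluation at ['X_ord_max], so a polynomial that vanishes there is zero. *)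
Lemma mpolyX_ord_max_transcendental (n : nat) (K : comNzRingType) :
  ~ algebraic_over (@mwiden n K) 'X_ord_max.
Proof.
case=> p p0 /rootP pX; case/eqP: p0; rewrite -(muni0 n K) -{}pX.
elim/poly_ind: p => [|p c {1}->]; first by rewrite map_poly0 horner0 muni0.
rewrite rmorphD rmorphM /= map_polyX map_polyC hornerMXaddC.
by rewrite muniD muniM muniX_ord_max muni_mwiden.
Qed.

(** Carries the independence of the [x i] over to the tower; since the constants are reached,
    generators over [K] also generate over the tower. *)
Lemma tower_mpoly (K : idomainType) (n : nat) :
  exists f : {rmorphism tower K n -> {mpoly K[n]}},
    injective f /\ forall c, exists b, f b = c%:MP.
Proof.
elim: n => [|n [f [inj_f fC]]].
  by exists (@mpolyC 0 K); split=> [|c]; [exact: can_inj (@mpolyCK 0 K)|exists c].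
have [g [inj_g gC gX]] := transcendental_extension (@inj_mwiden n K)
  (@mpolyX_ord_max_transcendental n K).
exists (g \o map_poly f); split=> [|c].
  exact: inj_comp inj_g (map_inj_poly inj_f (rmorph0 f)).
have [b fb] := fC c; exists b%:P; rewrite /= map_polyC /= fb.
by rewrite -(mwidenC n c); exact: gC.
Qed.

Lemma mmap_closed (n : nat) (K : nzRingType) (A : comNzRingType)
    (f : {rmorphism K -> A}) (h : 'I_n -> A) (P : A -> Prop) :
  (forall c, P (f c)) -> (forall i, P (h i)) ->
  (forall a b, P a -> P b -> P (a + b)) ->
  (forall a b, P a -> P b -> P (a * b)) -> forall p, P (mmap f h p).
Proof.
move=> Pf Ph PD PM p.
have P0 : P 0 by rewrite -(rmorph0 f).
have P1 : P 1 by rewrite -(rmorph1 f).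
apply: (big_ind P) => // m _; apply: (PM) => //.
apply: (big_ind P) => // i _.
by elim: (m i) => [|k IH]; rewrite ?expr0 // exprS; apply: PM.
Qed.

(** A transcendental [r] would be independent together with the [x i], which would give a chain of
    primes of length [n.+1]. *)
Lemma algebraic_over_krull_dim (K : fieldType) (R : comAlgType K) (n : nat)
    (x : 'I_n -> R) :
  GRing.integral_domain_axiom R -> finitely_generated R ->
  has_krull_dim R n -> alg_independent x ->
  forall r, algebraic_over (mmap (in_alg R) x) r.
Proof.
move=> domR [m [g gP]] [_ maxn] indx r; apply: contrapT => nalg_r.
have inj_x : injective (mmap (in_alg R) x).
  by apply: raddf_inj => p; apply: indx.
have [J [inj_J JC]] := tower_mpoly K n.
pose f : {rmorphism tower K n -> R} := mmap (in_alg R) x \o J.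
have inj_f : injective f by apply: inj_comp.
have nalg_f : ~ algebraic_over f r.
  by move=> alg_f; apply: nalg_r; apply: algebraic_over_comp inj_J _ alg_f.
have [F [inj_F FC FX]] := transcendental_extension inj_f nalg_f.
have gen_F : generated_over F (codom g).
  move=> P PF Pg PD PM a; have [p ->] := gP a; apply: mmap_closed => // [c|i].
    have [b Jb] := JC c; have := PF b%:P; rewrite FC /f /= Jb.
    by rewrite mmapC.
  by apply: Pg; rewrite codom_f.
have := maxn _ (@prime_chain_tower K n.+1 n.+1 R F _ domR inj_F gen_F (leqnn _)).
by rewrite ltnn.
Qed.

(** As long as the derivative vanishes at [a] it serves as an equation of smaller degree. If it is
    the zero polynomial, [p] is constant by [charB], and a nonzero constant has no root because [f]
    is injective. *)
Lemma separable_root (B : idomainType) (A : comNzRingType)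
    (f : {rmorphism B -> A}) (a : A) :
  injective f -> (forall (b : B) k, b *+ k.+1 = 0 -> b = 0) ->
  algebraic_over f a ->
  exists p : {poly B}, root (map_poly f p) a /\ ~~ root (map_poly f p^`()) a.
Proof.
move=> inj_f charB [p]; have [m] := ubnP (size p).
elim: m p => // m IH p; rewrite ltnS => sp p0 pa.
have [p'a|] := boolP (root (map_poly f p^`()) a); last by exists p.
have [p'0|p'0] := eqVneq p^`() 0; last first.
  exact: (IH _ (leq_trans (lt_size_deriv p0) sp)).
case/eqP: p0; have pC : p = (p`_0)%:P.
  apply/polyP => -[|k]; rewrite coefC //=.
  by apply: (charB _ k); rewrite -coef_deriv p'0 coef0.
move: pa; rewrite pC map_polyC rootC -(rmorph0 f) (inj_eq inj_f) => /eqP ->.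
by rewrite polyC0.
Qed.

(** * Monomials in commuting maps *)

Section MultiIter.
Context (A : zmodType) (n : nat) (d : 'I_n -> A -> A).

Lemma multi_iter_comm (g : A -> A) (alpha : 'X_{1..n}) (u : A) :
  (forall i v, d i (g v) = g (d i v)) ->
  multi_iter d alpha (g u) = g (multi_iter d alpha u).
Proof.
move=> dg; rewrite /multi_iter; elim: (index_enum _) => [|i s IH].
  by rewrite !big_nil.
rewrite !big_cons /= IH; elim: (alpha i) => //= k ->; exact: dg.
Qed.

(** The extra [d j] moves past the factors before index [j], which occurs exactly once in the
    enumeration. *)
Lemma multi_iter_mnmD1 (alpha : 'X_{1..n}) (j : 'I_n) (u : A) :
  (forall i k v, d i (d k v) = d k (d i v)) ->
  multi_iter d (alpha + U_(j))%MM u = d j (multi_iter d alpha u).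
Proof.
move=> dC; rewrite /multi_iter.
have := mem_index_enum j; have := index_enum_uniq 'I_n.
elim: (index_enum _) => // i s IH /= /andP[nis us].
rewrite !big_cons /= inE mnmDE mnm1E.
case: eqVneq nis => [<- njs _|neq_ij _ js].
  rewrite addn1 /=; congr (d j (iter _ _ (_ u))).
  apply: eq_big_seq => k ks; rewrite mnmDE mnm1E.
  by case: eqVneq ks njs => [<- ->|]; rewrite ?addn0.
rewrite addn0 IH //.
by elim: (alpha i) => //= k ->; rewrite dC.
Qed.

Lemma multi_iter0 (u : A) : multi_iter d 0%MM u = u.
Proof.
rewrite /multi_iter; elim: (index_enum _) => [|i s IH]; first by rewrite big_nil.
by rewrite big_cons /= IH mnm0E.
Qed.

Lemma multi_iter_filtration (P : nat -> A -> Prop) (alpha : 'X_{1..n})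
    (k : nat) (u : A) :
  (forall i j v, P j.+1 v -> P j (d i v)) ->
  P (k + mdeg alpha)%N u -> P k (multi_iter d alpha u).
Proof.
move=> dP; rewrite mdegE /multi_iter.
elim: (index_enum _) k => [|i s IH] k; first by rewrite !big_nil addn0.
rewrite !big_cons addnA => /IH /=.
elim: (alpha i) k => [|a IHa] k; first by rewrite addn0.
rewrite addnS -addSn => /IHa; exact: dP.
Qed.

End MultiIter.

(** * Commutators with multiplication operators *)

Section Commutators.
Context (K : fieldType) (R : comAlgType K).
Implicit Types (u v : KEnd R) (r : R).

Lemma mulopD r s : mulop (r + s) = mulop r + mulop s.
Proof. by apply: kend_ext => y; rewrite kendDE !mulopE mulrDl. Qed.

Lemma mulopM r s : mulop (r * s) = mulop r * mulop s.
Proof. by apply: kend_ext => y; rewrite kendME !mulopE mulrA. Qed.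

Lemma mulopC r s : mulop r * mulop s = mulop s * mulop r.
Proof. by rewrite -!mulopM mulrC. Qed.

Lemma adDr (A : nzRingType) (a b c : A) : ad a (b + c) = ad a b + ad a c.
Proof. by rewrite /ad mulrDr mulrDl opprD addrACA. Qed.

Lemma adMr (A : nzRingType) (a b c : A) :
  ad a (b * c) = ad a b * c + b * ad a c.
Proof. by rewrite /ad mulrBl mulrBr !mulrA addrA subrK. Qed.

Lemma adN (A : nzRingType) (a b : A) : ad a b = - ad b a.
Proof. by rewrite /ad opprB. Qed.

(** The Jacobi identity with [ad b c = 0]; the next two lemmas are sign variants of it. *)
Lemma ad_adC (A : nzRingType) (a b c : A) :
  b * c = c * b -> ad (ad a b) c = ad (ad a c) b.
Proof.
move=> bc; rewrite /ad !mulrBl !mulrBr !mulrA -(mulrA a b c) bc mulrA !opprB.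
by rewrite addrACA [RHS]addrACA; congr (_ + _); exact: addrC.
Qed.

Lemma ad_ad_comm (A : nzRingType) (a b c : A) :
  b * c = c * b -> ad b (ad c a) = ad c (ad b a).
Proof.
have adNN (y z : A) : ad y (ad z a) = ad (ad a z) y.
  by rewrite /ad -[a * z - _]opprB mulNr mulrN opprK addrC.
by move=> bc; rewrite !adNN ad_adC.
Qed.

Lemma ad_adA (A : nzRingType) (a b c : A) :
  b * c = c * b -> ad b (ad a c) = ad (ad b a) c.
Proof.
have adNl (y z : A) : ad (- y) z = - ad y z.
  by rewrite /ad mulNr mulrN opprB addrC opprK.
by move=> bc; rewrite (adN b) ad_adC // (adN b) adNl.
Qed.

Lemma order_le0_comm r u : order_le 0 u -> mulop r * u = u * mulop r.
Proof. by move=> /(ad_mulop0 r) /eqP; rewrite subr_eq0 => /eqP. Qed.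

(** The elements whose multiplication commutes with [u] form a subalgebra; scalars belong to it
    because [u] is [K]-linear. *)
Lemma ad_mulop_mmap (n : nat) (x : 'I_n -> R) u :
  (forall i, ad u (mulop (x i)) = 0) ->
  forall p, ad u (mulop (mmap (in_alg R) x p)) = 0.
Proof.
move=> ux; apply: (mmap_closed (P := fun a => ad u (mulop a) = 0))
  => // [c|a b ua ub|a b ua ub].
- apply: kend_ext => y; rewrite kendDE kendNE !kendME !mulopE /=.
  by rewrite !mulr_algl linearZ subrr.
- by rewrite mulopD adDr ua ub addr0.
- by rewrite mulopM adMr ua ub mul0r mulr0 addr0.
Qed.

(** A chain rule: being [R]-linear, [ad u (mulop r)] commutes with [mulop r], so the Leibniz terms
    collect into the derivative. *)
Lemma ad_mulop_horner (B : nzRingType) (f : {rmorphism B -> R}) r u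
    (p : {poly B}) :
  (forall b, ad u (mulop (f b)) = 0) -> order_le 0 (ad u (mulop r)) ->
  ad u (mulop (map_poly f p).[r]) =
    mulop (map_poly f p^`()).[r] * ad u (mulop r).
Proof.
move=> uf ur; elim/poly_ind: p => [|p c IH].
  have := uf 0; rewrite rmorph0 deriv0 map_poly0 horner0 => ->.
  by apply: kend_ext => y; rewrite kendME mulopE mul0r.
rewrite derivD derivM derivX derivC addr0 mulr1 !rmorphD !rmorphM /=.
rewrite map_polyX map_polyC !hornerE mulopD adDr uf addr0 mulopM adMr IH.
by rewrite -mulrA -(order_le0_comm _ ur) mulopD mulopM mulrDl mulrA.
Qed.

Lemma commuting_diffop_linear (n : nat) (x : 'I_n -> R) i u :
  [pchar K] =i pred0 -> GRing.integral_domain_axiom R -> alg_independent x ->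
  (forall r, algebraic_over (mmap (in_alg R) x) r) ->
  order_le i u -> (forall j, ad u (mulop (x j)) = 0) -> order_le 0 u.
Proof.
move=> charK domR indx algR; elim: i u => // i IH u ui ux.
suff ur r : ad u (mulop r) = 0.
  move=> r y; have /(congr1 (fun v : KEnd R => v y)) := ur r.
  by rewrite kendDE kendNE !kendME !mulopE => /eqP; rewrite subr_eq0 => /eqP.
have ur0 : order_le 0 (ad u (mulop r)).
  (* By the Jacobi identity [ad u (mulop r)] still commutes with the [x j], and its order bound is
     smaller by one. *)
  apply: IH (ui r) _ => j; rewrite ad_adC; last exact: mulopC.
  by rewrite ux /ad mul0r mulr0 subrr.
have inj_x : injective (mmap (in_alg R) x).
  by apply: raddf_inj => p; apply: indx.
have charB (b : {mpoly K[n]}) k : b *+ k.+1 = 0 -> b = 0.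
  move/eqP; rewrite -scaler_nat scaler_eq0.
  by rewrite (iffLR (pcharf0P K) charK) => /eqP.
have [p [/rootP pr p'r]] := separable_root inj_x charB (algR r).
have := ad_mulop_horner p (ad_mulop_mmap ux) ur0; rewrite pr => e.
apply: kend_ext => y; have := congr1 (fun v : KEnd R => v y) e.
rewrite kendME mulopE kendDE kendNE !kendME !mulopE !mul0r raddf0 subrr.
by move/esym/domR; rewrite -[_ == 0]/(root _ _) (negPf p'r) => /eqP.
Qed.

End Commutators.

(** The multiplier is the value at 1, which determines an [R]-linear map. *)
Lemma order_le0_mulop (K : fieldType) (R : comAlgType K) (u : KEnd R) :
  order_le 0 u <-> exists r, u = mulop r.
Proof.
split=> [u0|[r ->] s y]; last by rewrite !mulopE mulrCA.
exists (u 1); apply: kend_ext => y.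
by rewrite mulopE -{1}[y]mulr1 u0 mulrC.
Qed.

(** * The derivations [ad (x i)] and the order filtration *)

Theorem corollary2p6 (K : fieldType) (charK : [pchar K] =i pred0)
    (R : comAlgType K) (domR : GRing.integral_domain_axiom R)
    (fgR : finitely_generated R)
    (n : nat) (n_gt0 : (0 < n)%N) (dimR : has_krull_dim R n)
    (x : 'I_n -> R) (xP : alg_independent x) :
  let delta : 'I_n -> DiffOp R -> DiffOp R :=
    fun i => ad (diffop_mul (x i)) in
  [/\ forall i, derivation (delta i) /\ locally_nilpotent (delta i),
      forall i j u, delta i (delta j u) = delta j (delta i u),
      forall (i : nat) (u : DiffOp R),
        order_filtration i u <-> assoc_filtration delta i u
    & forall u : DiffOp R,
        (forall i, delta i u = 0) <-> exists r : R, u = diffop_mul r].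
Proof.
move=> delta.
have algR := algebraic_over_krull_dim domR fgR dimR xP.
(* [delta i] brackets with [x i] on the left and [order_le] brackets on the right, hence the
   sign. *)
have valD i (u : DiffOp R) :
    diffop_val (delta i u) = - ad (diffop_val u) (mulop (x i)).
  by rewrite /ad opprB.
have derD i : derivation (delta i).
  split=> [a u v|u v]; rewrite /delta /ad.
    by rewrite mulrDr mulrDl -scalerAr -scalerAl scalerBr opprD addrACA.
  exact: adMr.
have mulC r s : diffop_mul r * diffop_mul s = diffop_mul s * diffop_mul r.
  by apply: val_inj; apply: mulopC.
have deltaC i j u : delta i (delta j u) = delta j (delta i u).
  by apply: ad_ad_comm; exact: mulC.
have delta0 (u : DiffOp R) :
    (forall i, delta i u = 0) <-> order_filtration 0 u.
  split=> [du|u0 i]; last first.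
    by apply: val_inj; apply: etrans (valD i u) _; rewrite ad_mulop0 // oppr0.
  have /is_diffopP[k uk] := valP u.
  apply: (commuting_diffop_linear charK domR xP algR uk) => i.
  by apply/eqP; rewrite -oppr_eq0 -valD du.
(* The index is shifted by one so that delta also lowers it at order 0. *)
pose P k (u : DiffOp R) :=
  if k is k'.+1 then order_filtration k' u else u = 0.
have dP i k v : P k.+1 v -> P k (delta i v).
  case: k => [|k] /= vk; first by move/delta0: vk.
  by rewrite /order_filtration valD -scaleN1r; apply: order_leZ; apply: vk.
have PW k l v : (k <= l)%N -> P k v -> P l v.
  case: k l => [|k] [|l] //= kl; last exact: order_le_leq.
  by move=> ->; apply: order_le0.
have nilD i : locally_nilpotent (delta i).
  move=> u; have /is_diffopP[k uk] := valP u.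
  (* In the shifted filtration [u] has index [k.+1], so [k.+1] applications reach index 0, where
     only zero remains. *)
  exists k.+1; rewrite -[_ = 0]/(P 0%N _).
  have : P (k.+1 + 0)%N u by rewrite addn0.
  elim: k.+1 (0%N) => // m IH l; rewrite addSnnS => /IH; exact: dP.
have filtration i u : order_filtration i u <-> assoc_filtration delta i u.
  split=> [ui alpha|].
    move=> ia; rewrite -[_ = 0]/(P 0%N _).
    apply: (multi_iter_filtration (P := P)) dP _; exact: (PW i.+1 _ _ ia ui).
  elim: i u => [|i IH] u uN.
    apply/delta0 => i; rewrite -[u](multi_iter0 delta) -multi_iter_mnmD1 //.
    by apply: uN; rewrite mdegD mdeg1 addn1.
  move=> r.
  (* [g] commutes with the monomials in [delta], so it is enough that it kills
     [multi_iter delta alpha u] when [mdeg alpha] exceeds [i]. One more [delta j] kills that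
     element, so it is [R]-linear and commutes with [r]. *)
  pose g v : DiffOp R := ad v (diffop_mul r).
  apply: (IH (g u)) => alpha ia.
  rewrite (@multi_iter_comm _ _ _ g); last first.
    by move=> j v; apply: ad_adA; exact: mulC.
  have v0 : order_filtration 0 (multi_iter delta alpha u).
    apply/delta0 => j; rewrite -multi_iter_mnmD1 //.
    by apply: uN; rewrite mdegD mdeg1 addn1.
  by apply: val_inj; apply: ad_mulop0.
split=> // u; rewrite delta0 /order_filtration order_le0_mulop.
split=> -[r]; last by move=> ->; exists r.
by move=> ur; exists r; apply: val_inj.
Qed.
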